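(* Let $d\ge1$ and let $\alpha\in\mathbb{R}^d$ be an irrational vector. Let $v_1, \ldots, v_d \in \mathbb{Z}\alpha+\mathbb{Z}^d$, and let $P$ be a parallelepiped spanned by vectors $w_1, \ldots, w_d$ satisfying $$w_1 = v_1, \qquad w_k \in v_k + \operatorname{span}\{v_1, v_2, \dots, v_{k-1}\} \quad (2\leq k\leq d).$$ Then $P$ is a bounded remainder set (with respect to $\alpha$).
   Context: A vector $\alpha = (\alpha_1,\dots,\alpha_d) \in \mathbb{R}^d$ is called irrational if $1, \alpha_1, \ldots, \alpha_d$ are linearly independent over $\mathbb{Q}$. We write $\mathbb{Z}\alpha+\mathbb{Z}^d = \{ n\alpha + m : n \in \mathbb{Z}, m \in \mathbb{Z}^d\}$ and $\mathbb{T}^d = \mathbb{R}^d/\mathbb{Z}^d$. Here $\operatorname{span}$ is the real linear span. For a bounded measurable set $S \subset \mathbb{R}^d$ let $\chi_S(x) = \sum_{k \in \mathbb{Z}^d} \mathbf{1}_S(x+k)$, a $\mathbb{Z}^d$-periodic function regarded as a function on $\mathbb{T}^d$. A bounded measurable set $S \subset \mathbb{R}^d$ is a bounded remainder set (BRS) with respect to $\alpha$ if there is a constant $C = C(S,\alpha)$ such that for every $n \geq 1$ and almost every $x \in \mathbb{T}^d$, $\left| \sum_{k=0}^{n-1} \chi_S(x+k\alpha) - n \operatorname{mes} S \right| \leq C$, where $\operatorname{mes}$ is Lebesgue measure. A parallelepiped spanned by vectors $w_1,\dots,w_d$ is a set of the form $\{ \sum_{k=1}^d t_k w_k : 0 \leq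 t_k < 1 \}$, where $w_1,\dots,w_d$ are linearly independent vectors in $\mathbb{R}^d$. *)

(* Defs.v *)
From HB Require Import structures.
From mathcomp Require Import all_boot all_order all_algebra.
From mathcomp Require Import all_classical all_reals all_analysis.

Set Implicit Arguments.
Unset Strict Implicit.
Unset Printing Implicit Defensive.

Import Order.TTheory GRing.Theory Num.Theory.
Import numFieldNormedType.Exports.

Local Open Scope classical_set_scope.
Local Open Scope ring_scope.

Section lebesgue_cons.
Context {R : realType} {n : nat}.
Local Notation TR := (measurableTypeR R).

Definition tuple_cons (p : TR * n.-tuple TR) : n.+1.-tuple TR :=
  [tuple of p.1 :: p.2].

Lemma measurable_tuple_cons : measurable_fun [set: TR * n.-tuple TR] tuple_cons.
Proof. exact: measurable_cons. Qed.

Definition lebesgue_cons (mu : {sigma_finite_measure set (n.-tuple TR) -> \bar R})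
    : set (n.+1.-tuple TR) -> \bar R :=
  pushforward (@lebesgue_measure R \x mu)%E tuple_cons.

Variable mu : {sigma_finite_measure set (n.-tuple TR) -> \bar R}.

Let lebesgue_cons0 : lebesgue_cons mu set0 = 0%E.
Proof. by rewrite /lebesgue_cons /pushforward preimage_set0 measure0. Qed.

Let lebesgue_cons_ge0 A : (0 <= lebesgue_cons mu A)%E.
Proof. by rewrite /lebesgue_cons /pushforward; exact: measure_ge0. Qed.

Let lebesgue_cons_sigma_additive : semi_sigma_additive (lebesgue_cons mu).
Proof.
move=> F mF tF mUF; rewrite /lebesgue_cons /pushforward preimage_bigcup.
apply: measure_semi_sigma_additive.
- by move=> i; rewrite -[X in measurable X]setTI; exact: measurable_tuple_cons.
- apply/trivIsetP => /= i j _ _ ij; rewrite -preimage_setI.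
  by move/trivIsetP : tF => /(_ _ _ _ _ ij) ->//; rewrite preimage_set0.
- rewrite -preimage_bigcup -[X in measurable X]setTI.
  exact: measurable_tuple_cons.
Qed.

HB.instance Definition _ := isMeasure.Build _ _ _ (lebesgue_cons mu)
  lebesgue_cons0 lebesgue_cons_ge0 lebesgue_cons_sigma_additive.

Let lebesgue_cons_sigma_finite : sigma_finite setT (lebesgue_cons mu).
Proof.
have [F [FT mF]] : exists F : (set (TR * n.-tuple TR))^nat,
    setT = \bigcup_k F k /\ forall k, measurable (F k) /\
      ((@lebesgue_measure R \x mu) (F k) < +oo)%E.
  have /sigma_finiteP[G [TG ndG Goo]] := sigma_finiteT (@lebesgue_measure R).
  have /sigma_finiteP[H [TH ndH Hoo]] := sigma_finiteT mu.
  exists (fun k => G k `*` H k); split; last first.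
    move=> k; have [? ?] := Goo k; have [? ?] := Hoo k.
    split; first exact: measurableX.
    by rewrite product_measure1E// lte_mul_pinfty// ge0_fin_numE.
  rewrite -setXTT TG TH predeqE => -[x y]; split.
    move=> [/= [k _ Gkx] [l _ Hly]]; exists (maxn k l) => //; split.
    - by move: x Gkx; exact/subsetPset/ndG/leq_maxl.
    - by move: y Hly; exact/subsetPset/ndH/leq_maxr.
  by move=> [k _ []/= ? ?]; split; exists k.
pose g (t : n.+1.-tuple TR) : TR * n.-tuple TR :=
  (thead t, [tuple of behead t]).
have mg : measurable_fun [set: n.+1.-tuple TR] g.
  apply/measurable_fun_pair; last exact: measurable_behead.
  exact: measurable_tnth.
have gK : cancel tuple_cons g.
  by move=> [x t]; rewrite /g /tuple_cons theadE; congr pair; exact/val_inj.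
exists (fun k => g @^-1` F k).
  by rewrite -preimage_bigcup -FT preimage_setT.
move=> k; have [mFk Fkoo] := mF k; split.
  by rewrite -[X in measurable X]setTI; exact: mg.
rewrite /lebesgue_cons /pushforward -comp_preimage.
by rewrite (_ : g \o tuple_cons = id)//; apply/funext.
Qed.

HB.instance Definition _ := Measure_isSigmaFinite.Build _ _ _
  (lebesgue_cons mu) lebesgue_cons_sigma_finite.

End lebesgue_cons.

Fixpoint lebesgue_tuple (R : realType) (d : nat) :
    {sigma_finite_measure set (d.-tuple (measurableTypeR R)) -> \bar R} :=
  match d with
  | 0 => \d_([tuple] : 0.-tuple (measurableTypeR R))
  | d'.+1 => lebesgue_cons (lebesgue_tuple R d')
  end.

Section lebesgue_row.
Context {R : realType} {d : nat}.
Local Notation mu := (lebesgue_tuple R d).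
Local Notation completed_mu := (@completed_measure_extension _ _ _ mu).

(* Row vectors carry no measurable structure in the library: Lebesgue
   measurability, Lebesgue measure and null sets on R^d are those of d-tuples,
   read through the coordinate bijection. Measurable sets are the Caratheodory
   ones, i.e. the completion of the Borel sigma-algebra. *)
Definition row_of_tuple (t : d.-tuple (measurableTypeR R)) : 'rV[R]_d :=
  \row_i tnth t i.

Definition lebesgue_measurable (S : set 'rV[R]_d) : Prop :=
  (mu^*)%mu.-cara.-measurable (row_of_tuple @^-1` S).

Definition mes (S : set 'rV[R]_d) : \bar R :=
  completed_mu (row_of_tuple @^-1` S).

(* Z^d-periodic predicates on R^d are predicates on T^d = R^d / Z^d, whose
   measure is that of the fundamental domain [0, 1)^d. *)
Definition ae_torus (Q : 'rV[R]_d -> Prop) : Prop :=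
  {ae completed_mu, forall t : d.-tuple (measurableTypeR R),
    (forall i, 0 <= row_of_tuple t 0 i < 1) -> Q (row_of_tuple t)}.

End lebesgue_row.

Section bounded_remainder.
Context {R : realType} {d : nat}.
Implicit Types (alpha x : 'rV[R]_d) (S : set 'rV[R]_d).

Definition of_int_row (m : 'rV[int]_d) : 'rV[R]_d := map_mx intr m.

Definition irrational_vector alpha : Prop :=
  forall (c0 : rat) (c : 'I_d -> rat),
    ratr c0 + \sum_i ratr (c i) * alpha 0 i = 0 ->
    c0 = 0 /\ forall i, c i = 0.

Definition ZalphaZd alpha : set 'rV[R]_d :=
  [set x | exists (n : int) (m : 'rV[int]_d),
             x = n%:~R *: alpha + of_int_row m].

(* The finitely supported sum is 0 when infinitely many terms are nonzero;
   this never happens for a bounded set S. *)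
Definition chi S x : R :=
  \sum_(k \in [set: 'rV[int]_d]) (\1_S (x + of_int_row k) : R).

Definition bounded_remainder_set alpha S : Prop :=
  [/\ bounded_set S,
      lebesgue_measurable S &
      exists C : R, forall n : nat, (1 <= n)%N ->
        ae_torus (fun x =>
          `| \sum_(0 <= k < n) chi S (x + k%:R *: alpha)
             - n%:R * fine (mes S) | <= C)].

Definition parallelepiped (w : d.-tuple 'rV[R]_d) : set 'rV[R]_d :=
  [set x | exists t : 'I_d -> R,
             (forall k, 0 <= t k < 1) /\ x = \sum_k t k *: tnth w k].

Definition parallelepiped_spanned_by (P : set 'rV[R]_d)
    (w : d.-tuple 'rV[R]_d) : Prop :=
  free w /\ P = parallelepiped w.

End bounded_remainder.

(* Main.v *)
Require Import Defs.
From HB Require Import structures.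
From mathcomp Require Import all_boot all_order all_algebra.
From mathcomp Require Import all_classical all_reals all_analysis.
From mathcomp Require Import measurable_realfun zify ring lra.

(** The parallelepiped P is sheared, but the shear is triangular with respect
to v_1, ..., v_d: in the coordinates given by the v_k it is the image of the
unit cube [0,1)^d under a unitriangular matrix. Reducing the coordinates modulo
1 one at a time, starting from the last, shows that such a set meets every coset
of the lattice L spanned by v_1, ..., v_d in exactly one point
([trig_lattice_tile]), just as the parallelepiped of the v_k itself does.

Only this tiling property matters for the discrepancy. Visits of the orbit of x
to P are pairs (k, m) with x + k alpha + m in P and 0 <= k < N. Given another
starting point y, translate y + k alpha + m into P by the unique available
vector of L. As L lies in Z alpha + Z^d, this replaces (k, m) by another pair
(k', m'); the translation vector is bounded, because P and x - y are, hence so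
are its integer coordinates in the basis v, and hence so is k' - k. Uniqueness
in the tiling makes the correspondence injective. So x has at most O(1) more
visits up to time N than y has, uniformly in N, x and y ([visits_compare]).

Finally, the average over y in the unit cube of the number of visits up to time
N is N mes P, by invariance of Lebesgue measure under translations
([visits_integral]); a quantity within O(1) of all its competitors is within
O(1) of their average ([bounded_remainder_of_tile]). *)

Set Implicit Arguments.
Unset Strict Implicit.
Unset Printing Implicit Defensive.

Import Order.TTheory GRing.Theory Num.Theory.
Import numFieldNormedType.Exports.

Local Open Scope classical_set_scope.
Local Open Scope ring_scope.

(** * Counting visits *)

Section counting.
Context {R : realType} {d : nat}.
Implicit Types (x y z alpha : 'rV[R]_d) (S : set 'rV[R]_d) (V : 'M[R]_d).

Definition bounded_entries S (b : R) := forall x, S x -> forall i, `|x 0 i| <= b.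

(** A duplicate-free list rather than a cardinal, so that visit counts can be
compared through injections of lists. *)
Definition hits S z (l : seq 'rV[int]_d) :=
  uniq l /\ forall m, m \in l <-> S (z + of_int_row m).

(** Each coordinate of m is confined to a window of length 2b, whose position
depends on z but which contains at most 2b + 1 integers in any case. *)
Lemma hits_bounded S b : bounded_entries S b ->
  exists M : nat, forall z, exists2 l, hits S z l & (size l <= M)%N.
Proof.
move=> Sb.
(* The window is counted from the floor of its left end: hence the extra unit. *)
have [B hB] : exists B : nat, 2 * b + 1 < B%:R.
  by exists (Num.truncn (2 * b + 1)).+1; exact: truncnS_gt.
exists #|{: {ffun 'I_d -> 'I_B}}| => z.
pose e (f : {ffun 'I_d -> 'I_B}) : 'rV[int]_d :=
  \row_i (Num.floor (- b - z 0 i) + (f i)%:Z).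
exists [seq m <- undup (map e (enum {: {ffun 'I_d -> 'I_B}})) |
         `[< S (z + of_int_row m) >]]; last first.
  rewrite size_filter (leq_trans (count_size _ _))// (leq_trans (size_undup _))//.
  by rewrite size_map -cardE.
split; first by rewrite filter_uniq// undup_uniq.
move=> m; rewrite mem_filter mem_undup; split=> [/andP[/asboolP//]|Sm].
apply/andP; split; first exact/asboolP.
have H i : exists k : 'I_B, m 0 i = Num.floor (- b - z 0 i) + k%:Z.
  have := Sb _ Sm i; rewrite !mxE ler_norml => /andP[lo hi].
  have lom : Num.floor (- b - z 0 i) <= m 0 i.
    rewrite -(@ler_int R); apply: le_trans (floor_le _) _; lra.
  have him : m 0 i - Num.floor (- b - z 0 i) < B%:Z.
    rewrite -(@ltr_int R) intrD mulrNz.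
    have := floorD1_gt (- b - z 0 i); rewrite intrD => ?; rewrite -pmulrn; lra.
  have kB : (absz (m 0%R i - Num.floor (- b - z 0%R i))%R < B)%N.
    by lia.
  by exists (Ordinal kB); rewrite gez0_abs ?subr_ge0// addrC subrK.
have [f fE] := fin_all_exists H.
apply/mapP; exists [ffun i => f i]; first by rewrite mem_enum.
by apply/rowP => i; rewrite !mxE ffunE.
Qed.

Lemma chi_hits S z l : hits S z l -> chi S z = (size l)%:R.
Proof.
move=> [ul lP]; rewrite /chi (fsbigE l)//; last first.
  move=> m _ ml; rewrite indicE memNset// => Sm.
  by move: ml; rewrite (lP m).2.
rewrite (eq_bigl xpredT); last by move=> m; rewrite in_setT.
rewrite big_seq (eq_bigr (fun=> 1%:R)); last first.
  by move=> m /(lP m).1 Sm; rewrite indicE mem_set.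
by rewrite -big_seq -natr_sum sum1_size.
Qed.

Definition lattice_tile V S :=
  forall z, exists! c : 'rV[int]_d, S (z + of_int_row c *m V).

Definition visits alpha S N x := \sum_(0 <= k < N) chi S (x + k%:R *: alpha).

Lemma visits_hits alpha S N x (l : nat -> seq 'rV[int]_d) :
  (forall k, hits S (x + k%:R *: alpha) (l k)) ->
  visits alpha S N x = (size [seq (k, m) | k <- iota 0 N, m <- l k])%:R.
Proof.
move=> lP; rewrite /visits size_allpairs_dep sumnE big_map natr_sum.
by rewrite /index_iota subn0; apply: eq_bigr => k _; exact: chi_hits.
Qed.


Lemma of_int_rowD m1 m2 :
  of_int_row (m1 + m2) = of_int_row m1 + of_int_row m2 :> 'rV[R]_d.
Proof. exact: map_mxD. Qed.

(** A lattice generated inside Z alpha + Z^d lifts to Z x Z^d, linearly in the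
integer coordinates: n gives the time component and m the integer translation. *)
Lemma ZalphaZd_rows alpha V : (forall i, ZalphaZd alpha (row i V)) ->
  exists (n : 'cV[int]_d) (m : 'M[int]_d), forall c : 'rV[int]_d,
    of_int_row c *m V = ((c *m n) 0 0)%:~R *: alpha + of_int_row (c *m m).
Proof.
move=> /fin_all_exists[n /fin_all_exists[m nmE]].
exists (\col_i n i), (\matrix_(i, j) m i 0 j) => c.
apply/rowP => j; rewrite !mxE !rmorph_sum/= mulr_suml -big_split/=.
apply: eq_bigr => k _; rewrite !mxE !rmorphM/= -mulrA -mulrDr; congr (_ * _).
by have /rowP/(_ j) := nmE k; rewrite !mxE.
Qed.

(** The time component is a linear form in the integer coordinates, and these
are recovered linearly from the lattice vector since V is invertible. *)
Lemma linear_form_bounded V (n : 'cV[int]_d) (D : R) : V \in unitmx ->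
  exists K : nat, forall c : 'rV[int]_d,
    (forall i, `|(of_int_row c *m V) 0 i| <= D) ->
    (absz ((c *m n) 0 0)%R <= K)%N.
Proof.
move=> Vu; pose a : 'cV[R]_d := invmx V *m map_mx intr n.
exists (Num.truncn (\sum_i D * `|a i 0|)) => c cD.
rewrite truncn_ge_nat; last first.
  apply: sumr_ge0 => i _; rewrite mulr_ge0//.
  exact: le_trans (cD i).
suff -> : (absz ((c *m n) 0 0)%R)%:R = `|((of_int_row c *m V) *m a) 0 0|.
  rewrite mxE; apply: (le_trans (ler_norm_sum _ _ _)); apply: ler_sum => i _.
  by rewrite normrM ler_wpM2r.
rewrite /a mulmxA (mulmxK Vu) -(map_mxM intr c n) [in RHS]mxE -intr_norm.
by rewrite pmulrn abszE.
Qed.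

(** Starting K steps earlier and stopping K steps later adds only 2K times to the
window [0, N), and shifts all times to nonnegative ones. *)
Lemma visits_split alpha S (K N : nat) y :
  visits alpha S (N + K.*2) (y - K%:R *: alpha) =
  visits alpha S K (y - K%:R *: alpha) + visits alpha S N y +
  visits alpha S K (y + N%:R *: alpha).
Proof.
have visitsD N1 N2 z : visits alpha S (N1 + N2) z =
    visits alpha S N1 z + visits alpha S N2 (z + N1%:R *: alpha).
  rewrite /visits (big_cat_nat (leq0n _) (leq_addr N2 N1))/=; congr (_ + _).
  rewrite -{1}(add0n N1) big_addn addnC addnK; apply: eq_bigr => k _.
  by rewrite natrD scalerDl addrA addrAC.
rewrite -addnn addnCA !visitsD addrA subrK.
by congr (_ + _).
Qed.

Lemma absz_shift_inj (K a b : nat) (t : int) : (absz t <= K)%N ->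
  absz (a%:Z + K%:Z + t)%R = absz (b%:Z + K%:Z + t)%R -> a = b.
Proof. lia. Qed.

Lemma absz_shift_lt (K N a : nat) (t : int) : (absz t <= K)%N -> (a < N)%N ->
  (absz (a%:Z + K%:Z + t)%R < N + K.*2)%N.
Proof. lia. Qed.

(** A visit (k, m) of x is sent to the visit of y obtained by adding the only
lattice vector that brings y + k alpha + m into S. Times move by at most K, so
the image lies in the window [-K, N + K), of which only 2K times, each with
boundedly many visits, fall outside [0, N). *)
Lemma visits_compare alpha S V b D :
  bounded_entries S b -> lattice_tile V S -> V \in unitmx ->
  (forall i, ZalphaZd alpha (row i V)) ->
  exists C : R, forall N x y, (forall i, `|(x - y) 0 i| <= D) ->
    visits alpha S N x <= visits alpha S N y + C.
Proof.
move=> Sb tile Vu /ZalphaZd_rows[n [m nmE]].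
have [M hM] := hits_bounded Sb.
have [K hK] := linear_form_bounded n (D + 2 * b) Vu.
have /choice[cf cfP] z : exists c : 'rV[int]_d, S (z + of_int_row c *m V).
  by have [c []] := tile z; exists c.
have visitsM N x : visits alpha S N x <= (N * M)%:R.
  rewrite /visits natrM.
  rewrite -[X in X%:R * _](subn0 N) mulr_natl -sumr_const_nat.
  apply: ler_sum => k _.
  by have [l lP lM] := hM (x + k%:R *: alpha); rewrite (chi_hits lP) ler_nat.
exists ((K * M)%:R + (K * M)%:R) => N x y xyD.
have /choice[lx lxP] (k : nat) : exists l, hits S (x + k%:R *: alpha) l.
  by have [l ? _] := hM (x + k%:R *: alpha); exists l.
pose y' := y - K%:R *: alpha.
have /choice[ly lyP] (k : nat) : exists l, hits S (y' + k%:R *: alpha) l.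
  by have [l ? _] := hM (y' + k%:R *: alpha); exists l.
apply: (@le_trans _ _ (visits alpha S (N + K.*2) y')); last first.
  by rewrite visits_split (addrC (visits _ _ K _)) -addrA lerD2l lerD.
rewrite (visits_hits _ lxP) (visits_hits _ lyP) ler_nat.
pose orb z (p : nat * 'rV[int]_d) := z + p.1%:R *: alpha + of_int_row p.2.
pose c p := cf (orb y p).
(* The times k' lie in [-K, N + K); as natural numbers they are counted from -K,
   that is, along the orbit of y'. *)
pose phi (p : nat * 'rV[int]_d) : nat * 'rV[int]_d :=
  (absz (p.1%:Z + K%:Z + (c p *m n) 0 0)%R, p.2 + c p *m m).
set A := [seq (k, m) | k <- iota 0 N, m <- lx k].
have memA p : p \in A -> (p.1 < N)%N /\ S (orb x p).
  move=> /allpairsPdep[k [q [+ + ->]]]; rewrite mem_iota add0n => /= kN.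
  by move=> /(lxP k).2.
have orb_phi p : p \in A ->
    (absz ((c p *m n) 0 0)%R <= K)%N /\
    orb y p + of_int_row (c p) *m V = orb y' (phi p).
  move=> pA; have cK : (absz ((c p *m n) 0 0)%R <= K)%N.
    apply: hK => i.
    have := Sb _ (cfP (orb y p)) i; have := Sb _ (memA _ pA).2 i.
    have := xyD i; rewrite -/(c p) !mxE !ler_norml; lra.
  split=> //; rewrite /orb /phi nmE/= of_int_rowD.
  have -> : (absz (p.1%:Z + K%:Z + (c p *m n) 0 0)%R)%:R =
      p.1%:R + K%:R + ((c p *m n) 0 0)%:~R :> R.
    rewrite (pmulrn 1 (absz _)) gez0_abs; last by lia.
    by rewrite !rmorphD/=.
  apply/rowP => i; rewrite !mxE; ring.
(* If two visits of x have the same image, their positions in S differ by a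
   lattice vector, which the tiling forces to be 0. *)
have phi_inj : {in A &, injective phi}.
  move=> p q pA qA pq.
  have [[_ po] [_ qo]] := (orb_phi _ pA, orb_phi _ qA).
  have cE : c p = c q.
    have [u [_ uu]] := tile (orb x p).
    have e0 : u = 0.
      apply: uu; rewrite /of_int_row map_mx0 mul0mx addr0.
      exact: (memA _ pA).2.
    have : c p - c q = 0.
      rewrite -e0; apply/esym/uu; rewrite /of_int_row map_mxB mulmxBl.
      have -> : orb x p + (map_mx intr (c p) *m V - map_mx intr (c q) *m V) =
          orb x q.
        have : orb y p + of_int_row (c p) *m V =
            orb y q + of_int_row (c q) *m V by rewrite po qo pq.
        move=> /rowP E; apply/rowP => i; move: (E i); rewrite /orb !mxE; lra.
      exact: (memA _ qA).2.
    by move/eqP; rewrite subr_eq0 => /eqP.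
  move: pq; rewrite /phi -cE => -[] e1 /addIr e2.
  have [cK _] := orb_phi _ pA.
  have e1' := absz_shift_inj cK e1.
  by rewrite (surjective_pairing p) (surjective_pairing q) e1' e2.
rewrite -(size_map phi A); apply: uniq_leq_size.
  rewrite map_inj_in_uniq// allpairs_uniq_dep ?iota_uniq//.
    by move=> k _; exact: (lxP k).1.
  by move=> [? ?] [? ?] _ _ [] -> ->.
move=> _ /mapP[p pA ->]; have [cK po] := orb_phi _ pA.
apply/allpairsPdep; exists (phi p).1, (phi p).2.
rewrite -surjective_pairing; split=> //.
  have [pN _] := memA _ pA.
  by rewrite mem_iota leq0n add0n/= (absz_shift_lt cK pN).
by apply/(lyP _).2; rewrite -/(orb y' (phi p)) -po; exact: cfP.
Qed.

End counting.

(** * Unitriangular images of the unit cube tile *)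

Section triangular.
Context {R : realType} {d : nat}.
Implicit Types (T V W : 'M[R]_d) (t s u : 'rV[R]_d).

Definition unit_box t := forall i, 0 <= t 0 i < 1.

Lemma trig_mulmxE T u j : is_trig_mx T -> (forall i, T i i = 1) ->
  (u *m T) 0 j = u 0 j + \sum_(k < d | (j < k)%N) u 0 k * T k j.
Proof.
move=> /is_trig_mxP T0 T1; rewrite mxE (bigD1 j)//= T1 mulr1; congr (_ + _).
rewrite [LHS](bigID (fun k : 'I_d => (j < k)%N))/= addrC big1 ?add0r.
  by apply: eq_bigl => k; case: eqVneq => [->|]; rewrite ?ltnn.
move=> k /andP[kj]; rewrite -leqNgt => kj'.
by rewrite T0 ?mulr0// ltn_neqAle kj' andbT.
Qed.

(** Descending induction on the coordinate: once the later ones vanish, the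
coordinate of u T is that of u, hence an integer of absolute value less than 1. *)
Lemma trig_integral_eq0 T u (c : 'rV[int]_d) :
  is_trig_mx T -> (forall i, T i i = 1) ->
  (forall i, `|u 0 i| < 1) -> u *m T = of_int_row c -> u = 0.
Proof.
move=> Tt T1 u1 uT; apply/rowP => i; rewrite mxE.
have [n] := ubnP (d - i); elim: n i => // n IH i; rewrite ltnS => din.
have := trig_mulmxE u i Tt T1; rewrite uT !mxE big1 ?addr0; last first.
  move=> k ik; rewrite IH ?mul0r// (leq_trans _ din)//.
  have := ltn_ord k; lia.
move=> ci; have := u1 i; rewrite -ci -intr_norm -[ltRHS]/(1%:~R) ltr_int => c1.
by rewrite (_ : c 0 i = 0)//; lia.
Qed.

(** Existence by the same descent: the i-th coordinate of t T depends only on the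
t_k with k >= i, so t_i can be taken to be a fractional part after the later
t_k have been fixed. *)
Lemma trig_reduce T s : is_trig_mx T -> (forall i, T i i = 1) ->
  exists2 t, unit_box t & exists c : 'rV[int]_d, t *m T = s + of_int_row c.
Proof.
move=> Tt T1.
have : forall n, (n <= d)%N -> exists2 t, unit_box t &
    exists c : 'rV[int]_d, forall j : 'I_d, (d - n <= j)%N ->
      (t *m T) 0 j = s 0 j + (c 0 j)%:~R.
  elim=> [|n IH] nd.
    exists 0; first by move=> i; rewrite mxE lexx ltr01.
    by exists 0 => j; have := ltn_ord j; lia.
  have [t tb [c tc]] := IH (ltnW nd).
  have i0d : (d - n.+1 < d)%N by lia.
  pose i0 := Ordinal i0d.
  (* r is the value of t_i0 required to match s exactly. *)
  pose r := s 0 i0 - \sum_(k < d | (i0 < k)%N) t 0 k * T k i0.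
  pose t' : 'rV[R]_d := \row_i if i == i0 then r - (Num.floor r)%:~R else t 0 i.
  pose c' : 'rV[int]_d := \row_i if i == i0 then - Num.floor r else c 0 i.
  have tE (j : 'I_d) : (d - n.+1 <= j)%N ->
      \sum_(k < d | (j < k)%N) t' 0 k * T k j =
      \sum_(k < d | (j < k)%N) t 0 k * T k j.
    move=> ij; apply: eq_bigr => k jk; rewrite mxE ifF//.
    by apply/negbTE/eqP => ki0; move: jk; rewrite ki0 ltnNge ij.
  exists t'.
    move=> i; rewrite mxE; case: ifP => // _.
    have := floor_itv r; rewrite intrD; lra.
  exists c' => j ij; rewrite trig_mulmxE// tE// !mxE.
  case: eqVneq => [->|ji]; first by rewrite /r mulrNz; lra.
  have ij' : (d - n <= j)%N.
    have : (d - n.+1 != j)%N by apply: contra_neq ji => ij'; exact/ord_inj.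
    by move: ij; clear; lia.
  by rewrite -trig_mulmxE// tc.
move=> /(_ d (leqnn d))[t tb [c tc]]; exists t => //; exists c.
by apply/rowP => j; rewrite tc ?subnn// !mxE.
Qed.

(** The parallelepiped spanned by the rows of an invertible W, written as a
preimage of the unit box so that membership and measurability are immediate. *)
Definition box_image W := [set x | unit_box (x *m invmx W)].

(** In the coordinates of the basis V, a translate of z lies in the box image when
it equals t T with t in the unit box, while lattice vectors become integer rows:
this is the reduction of an arbitrary row modulo integers by the box of T. *)
Lemma trig_lattice_tile T V : T *m V \in unitmx -> V \in unitmx ->
  is_trig_mx T -> (forall i, T i i = 1) ->
  lattice_tile V (box_image (T *m V)).
Proof.
move=> Wu Vu Tt T1 z.
have [t tb [c tc]] := trig_reduce (z *m invmx V) Tt T1.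
exists c; split.
  rewrite /box_image/= (_ : z + _ = t *m (T *m V)) ?mulmxK//.
  by rewrite mulmxA tc mulmxDl mulmxKV.
move=> c'; rewrite {1}/box_image/= => tb'; set t' := (X in unit_box X) in tb'.
have E : (t - t') *m T = of_int_row (c - c').
  apply: (can_inj (mulmxK Vu)).
  rewrite -mulmxA [LHS]mulmxBl mulmxKV// mulmxA tc mulmxDl mulmxKV//.
  by rewrite /of_int_row map_mxB mulmxBl opprD addrACA subrr add0r.
have t0 : t - t' = 0.
  apply: trig_integral_eq0 E => // i; rewrite mxE [X in _ + X]mxE.
  have := tb i; have := tb' i; rewrite ltr_norml; lra.
move: E; rewrite t0 mul0mx => /rowP E; apply/rowP => i.
by move: (E i); rewrite !mxE => /esym/eqP; rewrite intr_eq0 subr_eq0 => /eqP.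
Qed.

Lemma span_take_coords k (v : d.-tuple 'rV[R]_d) x : (k <= d)%N ->
  x \in <<take k v>>%VS ->
  exists a : 'rV[R]_d, (forall j : 'I_d, (k <= j)%N -> a 0 j = 0) /\
    x = \sum_j a 0 j *: tnth v j.
Proof.
move=> kd; have sz : size (take k v) == k by rewrite size_takel ?size_tuple.
rewrite -[take k v]/(tval (Tuple sz)) => /coord_span ->.
set f := coord _; pose a (i : nat) := if insub i is Some j then f j x else 0.
exists (\row_j a j); split.
  by move=> j kj; rewrite mxE /a insubF// ltnNge kj.
transitivity (\sum_(i < k) a i *: v`_i).
  by apply: eq_bigr => i _; rewrite /a valK nth_take.
rewrite (big_ord_widen _ (fun i => a i *: v`_i) kd) big_mkcond/=.
apply: eq_bigr => j _; rewrite mxE (tnth_nth 0); case: ifPn => // jk.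
by rewrite /a insubF ?scale0r//; exact/negbTE.
Qed.

Lemma parallelepiped_box_image (w : d.-tuple 'rV[R]_d) : free w ->
  let W := \matrix_k tnth w k in
  W \in unitmx /\ parallelepiped w = box_image W.
Proof.
move=> /freeP fw W.
have WE (t : 'rV_d) : t *m W = \sum_k t 0 k *: tnth w k.
  by rewrite mulmx_sum_row; apply: eq_bigr => k _; rewrite rowK.
have Wu : W \in unitmx.
  rewrite -row_free_unit; apply: inj_row_free => t; rewrite WE => t0.
  apply/rowP => i; rewrite mxE; apply: (fw (fun i => t 0 i)).
  by apply: etrans t0; apply: eq_bigr => k _; rewrite (tnth_nth 0).
split=> //; apply/seteqP; split=> [x [t [tb ->]]|x xb].
  rewrite /box_image/= (_ : \sum_k _ = (\row_k t k) *m W) ?mulmxK//.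
    by move=> i; rewrite mxE.
  by rewrite WE; apply: eq_bigr => k _; rewrite mxE.
by exists (fun k => (x *m invmx W) 0 k); rewrite -WE mulmxKV.
Qed.

End triangular.

(** * Lebesgue measure on tuples: translations and the unit cube *)

Section measure.
Context {R : realType}.
Local Notation TR := (measurableTypeR R).

(** Lebesgue measure is determined by its values on half-open intervals, and
translation preserves their lengths. *)
Lemma lebesgue_measure_shift (a : R) (A : set TR) : measurable A ->
  lebesgue_measure ((fun x : TR => x + a : TR) @^-1` A) = lebesgue_measure A.
Proof.
have ma : measurable_fun [set: TR] (fun x : TR => x + a : TR).
  exact: measurable_funD.
pose m : {measure set TR -> \bar R} :=
  pushforward (@lebesgue_measure R) (fun x : TR => x + a : TR).
move=> mA; apply/esym; rewrite -[RHS]/(m ma A).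
apply: lebesgue_measure_unique => // _ [[x y] _ <-] /=; rewrite /m/= /pushforward.
have -> : (fun z : TR => z + a) @^-1` `]x, y] = `]x - a, y - a]%classic.
  by apply/seteqP; split=> z/=; rewrite !in_itv/=; lra.
by rewrite !lebesgue_measure_itv/= !lte_fin ltrD2r -!EFinB opprB addrA subrK.
Qed.

Section shift.
Context {d : nat}.

Definition tuple_shift (v : 'rV[R]_d) (t : d.-tuple TR) : d.-tuple TR :=
  [tuple tnth t i + v 0 i | i < d].

Lemma row_of_tuple_shift v t :
  row_of_tuple (tuple_shift v t) = row_of_tuple t + v.
Proof. by apply/rowP => i; rewrite !mxE tnth_mktuple. Qed.

Lemma measurable_tuple_shift v : measurable_fun setT (tuple_shift v).
Proof.
apply/measurable_fun_tnthP => i.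
rewrite (_ : _ \o _ = fun t => tnth t i + v 0 i).
  by apply: measurable_funD => //; exact: measurable_tnth.
by apply/funext => t /=; rewrite tnth_mktuple.
Qed.

Lemma measurable_boxes (A : set R) (f : 'I_d -> d.-tuple TR -> TR) :
  measurable (A : set TR) -> (forall i, measurable_fun setT (f i)) ->
  measurable [set t | forall i, A (f i t)].
Proof.
move=> mA mf.
rewrite (_ : [set t | _] = \bigcap_(i in [set: 'I_d]) (f i @^-1` A)).
  apply: fin_bigcap_measurable => // i _.
  by rewrite -[X in measurable X]setTI; exact: mf.
by apply/seteqP; split=> t/= H i; [move=> _|]; exact: H.
Qed.

End shift.

Lemma tuple_shift_cons d (v : 'rV[R]_d.+1) (a : TR) (t : d.-tuple TR) :
  tuple_shift v (tuple_cons (a, t)) =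
  tuple_cons ((a + v 0 ord0 : TR), tuple_shift (\row_i v 0 (lift ord0 i)) t).
Proof.
apply: eq_from_tnth => i; rewrite tnth_mktuple.
have [j ->|->] := unliftP ord0 i; last by rewrite !tnth0.
by rewrite !tnthS tnth_mktuple mxE.
Qed.

(** By induction, slicing along the first coordinate: the slices are translated
by the induction hypothesis, and the slice parameter by the invariance of
the measure on the line. *)
Lemma lebesgue_tuple_shift d (v : 'rV[R]_d) (A : set (d.-tuple TR)) :
  measurable A ->
  lebesgue_tuple R d (tuple_shift v @^-1` A) = lebesgue_tuple R d A.
Proof.
elim: d v A => [|d IH] v A mA.
  congr (_ _); apply/seteqP; split=> t; rewrite /preimage/=;
    by rewrite (tuple0 t) (tuple0 (tuple_shift _ _)).
rewrite /= /lebesgue_cons /pushforward /product_measure1.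
have mcA : measurable (tuple_cons @^-1` A : set (TR * d.-tuple TR)).
  by rewrite -[X in measurable X]setTI; exact: measurable_tuple_cons.
pose h (a : TR) : \bar R :=
  lebesgue_tuple R d (xsection (tuple_cons @^-1` A) a).
have mh : measurable_fun setT h by exact: measurable_fun_xsection.
pose s (a : TR) : TR := a + v 0 ord0.
have ms : measurable_fun setT s by exact: measurable_funD.
transitivity (\int[lebesgue_measure]_a (h \o s) a)%E.
  apply: eq_integral => a _ /=.
  rewrite /h /s -(IH (\row_i v 0 (lift ord0 i))); last first.
    exact: measurable_xsection.
  congr (_ _); apply/seteqP; split=> t;
    by rewrite /xsection/= !inE /preimage/= tuple_shift_cons.
transitivity (\int[pushforward lebesgue_measure s]_a h a)%E.
  by rewrite ge0_integral_pushforward// => a _; exact: measure_ge0.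
apply: eq_measure_integral => B mB _; exact: lebesgue_measure_shift.
Qed.

Lemma lebesgue_tuple_cube d :
  lebesgue_tuple R d [set t | forall i, 0 <= tnth t i < 1] = 1%E.
Proof.
elim: d => [|d IH].
  by rewrite /= diracE mem_set// => -[].
rewrite /= /lebesgue_cons /pushforward.
rewrite (_ : _ @^-1` _ =
    `[0, 1[%classic `*` [set t | forall i, 0 <= tnth t i < 1]).
  rewrite product_measure1E//; last first.
    apply: (@measurable_boxes _ `[0, 1[%classic (fun i t => tnth t i)) => // i.
    exact: measurable_tnth.
  rewrite IH mule1 -[LHS]/(lebesgue_measure (`[0%R, 1%R[%classic : set R)).
  by rewrite lebesgue_measure_itv/= lte_fin ltr01 -EFinB subr0.
apply/seteqP; split=> -[a t]/=.
  move=> H; split; first by have := H ord0; rewrite tnth0 in_itv.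
  by move=> i; have := H (lift ord0 i); rewrite tnthS.
move=> [+ H] i; rewrite in_itv/= => ha.
by have [j ->|->] := unliftP ord0 i; rewrite ?tnth0// tnthS.
Qed.

End measure.

(** * Averaging the number of visits over the unit cube *)

Section averaging.
Context {R : realType} {d : nat}.
Local Notation TR := (measurableTypeR R).
Local Notation mu := (lebesgue_tuple R d).
Implicit Types (alpha z : 'rV[R]_d) (S : set 'rV[R]_d).

Definition borel_row S := measurable (row_of_tuple @^-1` S : set (d.-tuple TR)).

Definition cube : set (d.-tuple TR) := row_of_tuple @^-1` unit_box.

Lemma cubeE : cube = [set t | forall i, 0 <= tnth t i < 1].
Proof. by apply/seteqP; split=> t /= H i; have := H i; rewrite mxE. Qed.

Lemma measurable_cube : measurable cube.
Proof.
rewrite cubeE.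
apply: (@measurable_boxes _ _ `[0, 1[%classic (fun i t => tnth t i)) => // i.
exact: measurable_tnth.
Qed.

Lemma mu_cube : mu cube = 1%E.
Proof. by rewrite cubeE; exact: lebesgue_tuple_cube. Qed.

Lemma measurable_shift_preimage v (A : set (d.-tuple TR)) : measurable A ->
  measurable (tuple_shift v @^-1` A).
Proof.
by move=> mA; rewrite -[X in measurable X]setTI; exact: measurable_tuple_shift.
Qed.

Lemma tuple_shift_rowE v S : tuple_shift v @^-1` (row_of_tuple @^-1` S) =
  [set t | S (row_of_tuple t + v)].
Proof. by apply/seteqP; split=> t; rewrite /preimage/= row_of_tuple_shift. Qed.

(** Unfolding: the translates of the unit cube by z + m, for integer m, partition
R^d, and the average of chi over the cube adds up the measures of the
corresponding pieces of S, finitely many of which are nonempty. *)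
Lemma chi_integral S b z : bounded_entries S b -> borel_row S ->
  measurable_fun cube (fun t => (chi S (row_of_tuple t + z))%:E) /\
  (\int[mu]_(t in cube) (chi S (row_of_tuple t + z))%:E =
   mu (row_of_tuple @^-1` S))%E.
Proof.
move=> Sb mS.
(* For t in the cube, t + z + m is within 1 of z + m, so that only the m for
   which z + m has entries at most b + 1 in absolute value contribute. *)
have [_ /(_ z)[l [ul lP] _]] := @hits_bounded R d
  [set x | forall i, `|x 0 i| <= b + 1] (b + 1) (fun x h => h).
pose A m := tuple_shift (z + of_int_row m) @^-1` (row_of_tuple @^-1` S).
have mA m : measurable (A m) by exact: measurable_shift_preimage.
have chiE t : cube t ->
    ((chi S (row_of_tuple t + z))%:E = \sum_(m <- l) (\1_(A m) t)%:E)%E.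
  move=> ct; rewrite sumEFin /chi; congr (_%:E).
  rewrite (fsbigE l)//=; last first.
    move=> m _ ml; rewrite indicE memNset// => Sm; move/negP: ml; apply.
    apply/lP => i; have := Sb _ Sm i; have := ct i.
    by rewrite !mxE !ler_norml; lra.
  rewrite (eq_bigl xpredT) => [|m]; last by rewrite in_setT.
  apply: eq_bigr => m _; rewrite !indicE; congr (_%:R).
  congr (nat_of_bool _); apply/idP/idP;
    by rewrite !inE /A tuple_shift_rowE/= addrA.
have m1 m : measurable_fun cube (fun t => (\1_(A m) t)%:E : \bar R).
  by apply/measurable_EFinP; exact: measurable_indic.
split.
  apply: (eq_measurable_fun (fun t => \sum_(m <- l) (\1_(A m) t)%:E)%E).
    by move=> t; rewrite inE => /chiE.
  exact: emeasurable_sum.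
under eq_integral => t do (rewrite inE => /chiE ->).
rewrite ge0_integral_sum//; last exact: measurable_cube.
pose B m := (row_of_tuple @^-1` S) `&`
  (tuple_shift (- (z + of_int_row m)) @^-1` cube).
have mB m : measurable (B m).
  apply: measurableI => //; apply: measurable_shift_preimage.
  exact: measurable_cube.
have -> : row_of_tuple @^-1` S = \bigcup_(m in [set` l]) B m.
  apply/seteqP; split=> [t St|t [m _ []]//].
  pose m : 'rV[int]_d := \row_i Num.floor (tnth t i - z 0 i).
  exists m.
    apply/lP => i; have := Sb _ St i; rewrite !mxE !ler_norml.
    have := floor_itv (tnth t i - z 0 i); rewrite intrD; lra.
  split=> //; rewrite /cube tuple_shift_rowE => i; rewrite !mxE.
  have := floor_itv (tnth t i - z 0 i); rewrite intrD; lra.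
rewrite measure_fin_bigcup//; last first.
  move=> m m' _ _ [t [[_ +] [_ +]]]; rewrite /cube !tuple_shift_rowE => h h'.
  apply/rowP => i; have := h i; have := h' i; rewrite !mxE => hi hi'.
  have lt (p q : int) : (p%:~R : R) < q%:~R + 1 -> p <= q.
    by move=> pq; rewrite -ltzD1 -(@ltr_int R) intrD.
  by apply/eqP; rewrite eq_le !lt//; lra.
  exact: finite_seq.
rewrite -fsbig_seq//; apply: eq_bigr => m _.
rewrite integral_indic//; last exact: measurable_cube.
have mAc : measurable (A m `&` cube).
  by apply: measurableI => //; exact: measurable_cube.
apply: etrans (esym (lebesgue_tuple_shift (- (z + of_int_row m)) mAc)) _.
congr (mu _); rewrite preimage_setI /B; congr (_ `&` _).
by rewrite /A tuple_shift_rowE; apply/seteqP; split=> t;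
  rewrite /preimage/= row_of_tuple_shift addrNK.
Qed.

Lemma visits_integral alpha S b N : bounded_entries S b -> borel_row S ->
  measurable_fun cube (fun t => (visits alpha S N (row_of_tuple t))%:E) /\
  (\int[mu]_(t in cube) (visits alpha S N (row_of_tuple t))%:E =
   N%:R%:E * mu (row_of_tuple @^-1` S))%E.
Proof.
move=> Sb mS; have H k := chi_integral (k%:R *: alpha) Sb mS.
under eq_integral do rewrite /visits -sumEFin.
under eq_fun do rewrite /visits -sumEFin.
split; first by apply: emeasurable_sum => k; exact: (H k).1.
rewrite ge0_integral_sum//; first 1 last.
- exact: measurable_cube.
- by move=> k; exact: (H k).1.
- by move=> k t _; rewrite lee_fin; apply: fsumr_ge0 => m _; rewrite indicE.
under eq_bigr do rewrite (H _).2.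
elim: N => [|N IH]; first by rewrite big_geq// mul0e.
by rewrite big_nat_recr//= IH -natr1 EFinD ge0_muleDl ?mul1e// lee_fin.
Qed.

Lemma visits_ge0 alpha S N x : 0 <= visits alpha S N x.
Proof.
by apply: sumr_ge0 => k _; apply: fsumr_ge0 => m _; rewrite indicE.
Qed.

(** Integrate the bound over the unit cube, which has measure 1. For N = 1 this
is what shows that S has finite measure. *)
Lemma bounded_visits_mes alpha S b a N : bounded_entries S b -> borel_row S ->
  (forall t, cube t -> visits alpha S N (row_of_tuple t) <= a) ->
  (N%:R%:E * mu (row_of_tuple @^-1` S) <= a%:E)%E.
Proof.
move=> Sb mS va; have [mv <-] := visits_integral alpha N Sb mS.
rewrite -[leRHS]mule1 -mu_cube -integral_cst; last exact: measurable_cube.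
have a0 t : cube t -> 0 <= a.
  by move=> ct; apply: le_trans (va t ct); exact: visits_ge0.
apply: ge0_le_integral => //.
- exact: measurable_cube.
- by move=> t _; rewrite lee_fin visits_ge0.
Qed.

Lemma mes_bounded_visits alpha S b a N : bounded_entries S b -> borel_row S ->
  (forall t, cube t -> a <= visits alpha S N (row_of_tuple t)) ->
  (a%:E <= N%:R%:E * mu (row_of_tuple @^-1` S))%E.
Proof.
move=> Sb mS va; have [a0|a0] := leP 0 a; last first.
  by apply: (@le_trans _ _ 0%E); [rewrite lee_fin ltW|rewrite mule_ge0// lee_fin].
have [mv <-] := visits_integral alpha N Sb mS.
rewrite -[leLHS]mule1 -mu_cube -integral_cst; last exact: measurable_cube.
by apply: ge0_le_integral => //; exact: measurable_cube.
Qed.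

Lemma borel_row_mes S : borel_row S ->
  lebesgue_measurable S /\ mes S = mu (row_of_tuple @^-1` S).
Proof.
move=> mS; split; last exact: measurable_mu_extE.
by apply: sub_caratheodory; exact: sub_sigma_algebra.
Qed.

Lemma bounded_entries_set S b : bounded_entries S b -> bounded_set S.
Proof.
move=> Sb; exists `|b|; split; first exact: num_real.
move=> M bM x Sx; suff: mx_norm x <= M by [].
have [->|/mx_norm_neq0[i ->]] := eqVneq (mx_norm x) 0.
  by apply: le_trans (ltW bM).
rewrite ord1; exact: le_trans (Sb _ Sx _) (le_trans (ler_norm b) (ltW bM)).
Qed.

(** By [visits_compare], the visits from x differ by at most C from those from
any y in the cube; averaging over y turns the latter into N mes S. *)
Lemma bounded_remainder_of_tile alpha S b (V : 'M[R]_d) :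
  bounded_entries S b -> borel_row S -> lattice_tile V S -> V \in unitmx ->
  (forall i, ZalphaZd alpha (row i V)) -> bounded_remainder_set alpha S.
Proof.
move=> Sb mS tile Vu VZ; have [Sm mesE] := borel_row_mes mS.
split=> //; first exact: bounded_entries_set Sb.
have [C cmp] := visits_compare 1 Sb tile Vu VZ.
have {}cmp N x y : unit_box x -> unit_box y ->
    visits alpha S N x <= visits alpha S N y + C.
  move=> xb yb; apply: cmp => i; rewrite !mxE.
  by have := xb i; have := yb i; rewrite ler_norml; lra.
have box0 : unit_box (0 : 'rV[R]_d) by move=> i; rewrite mxE lexx ltr01.
have up N x : unit_box x ->
    (N%:R%:E * mu (row_of_tuple @^-1` S) <= (visits alpha S N x + C)%:E)%E.
  by move=> xb; apply: (bounded_visits_mes Sb mS) => t tb; exact: cmp.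
have fin : (mu (row_of_tuple @^-1` S) \is a fin_num).
  rewrite ge0_fin_numE//; have := up 1%N _ box0; rewrite mul1e.
  by move/le_lt_trans; apply; rewrite ltry.
exists C => N _; apply: aeW => t xb; set x := row_of_tuple t in xb *.
rewrite mesE -/(visits alpha S N x).
have lo : ((visits alpha S N x - C)%:E <= N%:R%:E * mu (row_of_tuple @^-1` S))%E.
  apply: (mes_bounded_visits Sb mS) => t' tb; rewrite lerBlDr; exact: cmp.
have := up N _ xb; move: lo; rewrite -{1 2}(fineK fin) -EFinM !lee_fin ler_norml.
lra.
Qed.

End averaging.

(** * Parallelepipeds *)

Section box_image.
Context {R : realType} {d : nat}.
Implicit Types (W : 'M[R]_d).

Lemma box_image_bounded W : W \in unitmx ->
  bounded_entries (box_image W) (\sum_i \sum_k `|W k i|).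
Proof.
move=> Wu x xb i; rewrite -[x](mulmxKV Wu) mxE.
apply: (@le_trans _ _ (\sum_k `|W k i|)); last first.
  rewrite [leRHS](bigD1 i)//= lerDl; apply: sumr_ge0 => j _.
  exact: sumr_ge0.
apply: le_trans (ler_norm_sum _ _ _) _; apply: ler_sum => k _.
have /andP[t0 t1] := xb k.
by rewrite normrM ler_piMl// ger0_norm// ltW.
Qed.

Lemma box_image_borel W : borel_row (box_image W).
Proof.
apply: (@measurable_boxes _ _ `[0, 1[%classic
  (fun i t => (row_of_tuple t *m invmx W) 0 i)) => // i.
under eq_fun do rewrite mxE.
apply: measurable_sum => k; apply: measurable_funM => //.
under eq_fun do rewrite mxE; exact: measurable_tnth.
Qed.

End box_image.

Theorem theorem3p8 (R : realType) (d : nat) (d_gt0 : (0 < d)%N)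
    (alpha : 'rV[R]_d) (alpha_irr : irrational_vector alpha)
    (v w : d.-tuple 'rV[R]_d)
    (v_in : forall k : 'I_d, ZalphaZd alpha (tnth v k))
    (P : set 'rV[R]_d) (P_spanned : parallelepiped_spanned_by P w)
    (w_first : tnth w (Ordinal d_gt0) = tnth v (Ordinal d_gt0))
    (w_next : forall k : 'I_d, (0 < k)%N ->
       tnth w k - tnth v k \in <<take k v>>%VS) :
  bounded_remainder_set alpha P.
Proof.
have [w_free ->] := P_spanned.
have [] := parallelepiped_box_image w_free.
set W := \matrix_k tnth w k => Wu ->.
pose V := \matrix_k tnth v k.
have /fin_all_exists[a aP] (k : 'I_d) : exists a : 'rV[R]_d,
    (forall j : 'I_d, (k <= j)%N -> a 0 j = 0) /\
    tnth w k - tnth v k = \sum_j a 0 j *: tnth v j.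
  apply: span_take_coords; first exact: ltnW.
  have [k0|] := posnP k; last exact: w_next.
  by rewrite (_ : k = Ordinal d_gt0) ?w_first ?subrr ?mem0v//; exact/val_inj.
pose T : 'M[R]_d := \matrix_(k, j) ((k == j)%:R + a k 0 j).
have WTV : W = T *m V.
  apply/row_matrixP => k; rewrite row_mul rowK mulmx_sum_row.
  rewrite -[LHS](subrK (tnth v k)) (aP k).2.
  under [RHS]eq_bigr do rewrite !mxE rowK scalerDl.
  rewrite big_split/= addrC; congr (_ + _).
  rewrite (bigD1 k)//= eqxx scale1r big1 ?addr0// => j jk.
  by rewrite eq_sym (negPf jk) scale0r.
have Tt : is_trig_mx T.
  apply/is_trig_mxP => k j kj; rewrite mxE (aP k).1 ?(ltnW kj)// addr0.
  rewrite (_ : (k == j) = false)//.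
  by apply/negbTE/eqP => kj'; rewrite kj' ltnn in kj.
have T1 k : T k k = 1 by rewrite mxE eqxx (aP k).1 ?addr0.
have Vu : V \in unitmx by move: Wu; rewrite WTV unitmx_mul => /andP[].
apply: (bounded_remainder_of_tile
  (box_image_bounded Wu) (box_image_borel W) _ Vu).
  by have := @trig_lattice_tile _ _ T V; rewrite -WTV; apply.
by move=> k; rewrite rowK.
Qed.
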